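(* Let $e : X \to Y$ be a compactification of a completely regular space $X$ and $e^\flat : C(Y) \to B(X)$, $e^\flat(f)=f\circ e$, the corresponding basic extension. Then $e^\flat$ satisfies (SL) iff $X$ is Lindelöf and $e$ is isomorphic to the Stone–Čech compactification $s : X \to \beta X$. Here (SL) is the condition: whenever $S,T\subseteq C(Y)$ are such that $\bigwedge e^\flat[S] \le \bigvee e^\flat[T]$, there are countable subsets $S' \subseteq S$, $T' \subseteq T$, and $a \in C(Y)$ with $\bigwedge e^\flat[S'] \le e^\flat(a) \le \bigvee e^\flat[T']$.
   Context: Completely regular spaces are Hausdorff. A compactification of a completely regular space $X$ is a topological embedding $e:X\to Y$ into a compact Hausdorff space $Y$ with $e[X]$ dense in $Y$. The category of compactifications has compactifications $e:X\to Y$ as objects, and a morphism from $e:X\to Y$ to $e':X'\to Y'$ is a pair $(f,g)$ of continuous maps $f:X\to X'$, $g:Y\to Y'$ with $g\circ e=e'\circ f$; ''isomorphic'' refers to this category. $C(Y)$ is the $\ell$-algebra (lattice-ordered $\mathbb R$-algebra) of continuous real-valued functions on $Y$, and $B(X)$ the $\ell$-algebra of all bounded real-valued functions on $X$, with pointwise operations and order. Joins and meets in the formulas are taken in $B(X)$ and are presupposed to exist there. A completely regular space $X$ is Lindelöf if each open cover of $X$ has a countable subcover. *)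

(* Defs.v *)
From HB Require Import structures.
From mathcomp Require Import all_boot all_order all_algebra.
From mathcomp Require Import all_classical all_reals all_analysis.

Set Implicit Arguments.
Unset Strict Implicit.
Unset Printing Implicit Defensive.

Import Order.TTheory GRing.Theory Num.Theory.
Import numFieldNormedType.Exports.

Local Open Scope classical_set_scope.
Local Open Scope ring_scope.

(* [completely_regular_space] does not imply Hausdorff; by
   [uniform_separatorP] it says that continuous functions into the unit
   interval separate points from closed sets. *)
Definition completely_regular (X : topologicalType) : Prop :=
  hausdorff_space X /\ completely_regular_space X.

Definition lindelof (X : topologicalType) : Prop :=
  forall U : set (set X), (forall u, U u -> open u) ->
    \bigcup_(u in U) u = [set: X] ->
    exists V : set (set X),
      [/\ V `<=` U, countable V & \bigcup_(u in V) u = [set: X]].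

Definition topological_embedding (X Y : topologicalType) (e : X -> Y) : Prop :=
  [/\ injective e, continuous e &
      forall U : set X, open U -> exists2 V, open V & e @` U = V `&` range e].

Record compactification (X Y : topologicalType) := Compactification {
  compactification_map :> X -> Y;
  compactification_compact : compact [set: Y];
  compactification_hausdorff : hausdorff_space Y;
  compactification_embedding : topological_embedding compactification_map;
  compactification_dense : dense (range compactification_map)
}.

Definition compactification_morphism (X Y X' Y' : topologicalType)
    (e : compactification X Y) (e' : compactification X' Y')
    (f : X -> X') (g : Y -> Y') : Prop :=
  [/\ continuous f, continuous g & g \o e = e' \o f].

Definition compactification_isomorphic (X Y X' Y' : topologicalType)
    (e : compactification X Y) (e' : compactification X' Y') : Prop :=
  exists (f : X -> X') (g : Y -> Y') (f' : X' -> X) (g' : Y' -> Y),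
    [/\ compactification_morphism e e' f g,
        compactification_morphism e' e f' g',
        cancel f f' /\ cancel f' f &
        cancel g g' /\ cancel g' g].

Section StoneCech.
Context (R : realType) (X : topologicalType).

Definition unit_cfun : set (continuousType X R) :=
  [set f | range f `<=` `[0, 1]].

Definition stone_cech_eval (x : X) : {ptws unit_cfun -> R} :=
  fun f => set_val f x.

(* The closure in the full power of the line agrees with the closure in the
   cube, since the cube is closed. *)
Definition stone_cech_space : topologicalType :=
  set_type (closure (range stone_cech_eval)).

Lemma stone_cech_eval_closure (x : X) :
  stone_cech_eval x \in closure (range stone_cech_eval).
Proof. by apply/mem_set/subset_closure; exists x. Qed.

Definition stone_cech_fun (x : X) : stone_cech_space :=
  exist _ (stone_cech_eval x) (stone_cech_eval_closure x).

Lemma stone_cech_space_compact : compact [set: stone_cech_space].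
Proof.
have cube : compact (closure (range stone_cech_eval)).
  pose C := [set p : {ptws unit_cfun -> R} | forall f, `[(0:R), 1]%classic (p f)].
  have cC : compact C.
    exact: (@tychonoff unit_cfun (fun=> R) (fun=> `[(0:R), 1]%classic)
      (fun=> @segment_compact R 0 1)).
  apply: (subclosed_compact _ cC); first exact: closed_closure.
  have hC : hausdorff_space {ptws unit_cfun -> R}.
    by apply: hausdorff_product => _; exact: norm_hausdorff.
  rewrite ((closure_id C).1 (compact_closed hC cC)).
  apply: closure_subset => _ [x _ <-] f.
  by apply: (set_valP f); exists x.
move=> F PF _.
have [p [clp clF]] := cube (set_val @ F) _ (filterS (fun z _ => set_valP z) filterT).
exists (exist _ p (mem_set clp)); split=> // U V FU.
rewrite nbhsE => -[W [[W' oW' <-] W'p] WV].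
have FU' : (set_val @ F) (set_val @` U).
  by apply: (@filterS _ F _ U) FU => z Uz; exists z.
have nW' : nbhs p W' by apply: open_nbhs_nbhs; split.
have [q [[z Uz <-] W'z]] := clF _ _ FU' nW'.
by exists z; split=> //; exact: WV.
Qed.

Lemma stone_cech_space_hausdorff : hausdorff_space stone_cech_space.
Proof.
have hC : hausdorff_space {ptws unit_cfun -> R}.
  by apply: hausdorff_product => _; exact: norm_hausdorff.
move=> p q clpq; apply: val_inj; apply: hC => U V nU nV.
have [z [Uz Vz]] : (set_val @^-1` U : set stone_cech_space) `&`
    (set_val @^-1` V) !=set0.
  by apply: clpq; apply: initial_continuous.
by exists (set_val z).
Qed.

Context (crX : completely_regular X).

Let evals (f : unit_cfun) : X -> R := set_val f.

Let evals_continuous (f : unit_cfun) : continuous (evals f).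
Proof. exact: cts_fun. Qed.

Let evals_separate : separate_points_from_closed evals.
Proof.
move=> U x clU nUx.
have [f [cf f01 fx fU]] := (uniform_separatorP (R := R) _ _).1 (crX.2 x U clU nUx).
pose g : continuousType X R := mkcts cf.
have ug : unit_cfun g by [].
exists (exist _ g (mem_set ug)) => /=.
have fx0 : f x = 0 by apply: fx; exists x.
move/closure_subset: fU => fU /fU.
rewrite -((closure_id [set (1 : R)]).1 _); last first.
  exact/accessible_closed_set1/hausdorff_accessible/norm_hausdorff.
by move=> fx1; have /eqP : f x = 1 := fx1; rewrite fx0 eq_sym oner_eq0.
Qed.

Let evals_initial := join_product_initial evals_separate evals_continuous.

Lemma stone_cech_fun_embedding : topological_embedding stone_cech_fun.
Proof.
have accX := hausdorff_accessible crX.1.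
have inj := join_product_inj evals_separate accX.
split.
- by move=> x y /(congr1 val) /= /inj; apply; rewrite in_setT.
- apply/continuousP => _ [W oW <-].
  have /continuousP := join_product_continuous evals_separate evals_continuous.
  exact.
- move=> U; rewrite (evals_initial inj) => -[W oW <-].
  exists (set_val @^-1` W); first by exists W.
  rewrite eqEsubset; split=> [_ [x Wx <-]|z [Wz [x _ xz]]]; first by split.
  by exists x => //; rewrite -xz in Wz.
Qed.

Lemma stone_cech_fun_dense : dense (range stone_cech_fun).
Proof.
move=> U [z Uz] [W oW WU]; have Wz : W (set_val z) by rewrite -WU in Uz.
have [_ [[x _ <-] Wx]] := set_valP z _ (open_nbhs_nbhs (conj oW Wz)).
by exists (stone_cech_fun x); split; [rewrite -WU | exists x].
Qed.

Definition stone_cech : compactification X stone_cech_space :=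
  Compactification stone_cech_space_compact stone_cech_space_hausdorff
    stone_cech_fun_embedding stone_cech_fun_dense.

End StoneCech.

Section BoundedFunctions.
Context (R : realType) (X : Type).

Definition bfun : Type := {f : X -> R | f \in (bounded_fun : set (X -> R))}.

HB.instance Definition _ := SubType.on bfun.
HB.instance Definition _ := [Choice of bfun by <:].
(* [FunOrder.fun_display] is the display of the pointwise order on [X -> R]. *)
HB.instance Definition _ :=
  [SubChoice_isSubPOrder of bfun by <: with FunOrder.fun_display].

End BoundedFunctions.

Section BasicExtension.
Context (R : realType) (X Y : topologicalType) (e : compactification X Y).

Lemma basic_extension_bounded (f : continuousType Y R) :
  f \o e \in (bounded_fun : set (X -> R)).
Proof.
have /compact_bounded [M [Mr fM]] : compact (range f).
  apply: (continuous_compact _ (compactification_compact e)).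
  exact/continuous_subspaceT/cts_fun.
by apply/mem_set; exists M; split=> // N MN x _; apply: fM => //; exists (e x).
Qed.

Definition basic_extension (f : continuousType Y R) : bfun R X :=
  exist _ (f \o e) (basic_extension_bounded f).

(* Every infimum and supremum is taken in [bfun R X]; those in the conclusion
   are asserted to exist. *)
Definition SL : Prop :=
  forall (S T : set (continuousType Y R)) (g h : bfun R X),
    infimums (basic_extension @` S) g ->
    supremums (basic_extension @` T) h ->
    (g <= h)%O ->
    exists (S' T' : set (continuousType Y R)) (a : continuousType Y R)
        (g' h' : bfun R X),
      [/\ S' `<=` S /\ countable S',
          T' `<=` T /\ countable T',
          infimums (basic_extension @` S') g',
          supremums (basic_extension @` T') h' &
          (g' <= basic_extension a <= h')%O].

End BasicExtension.

(* Main.v *)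
(** (SL) applied to S = {1} and T the functions with values in [0, 1] whose
    restriction to X lives in a member of an open cover of X yields a countable
    subcover.  Applied to S = {f | f o e >= u} and T = {f | f o e <= u} for a
    continuous u : X -> [0, 1], it yields an a with a o e = u, so e has the
    extension property characterizing the Stone-Cech compactification.

    Conversely, if X is Lindelof, then inf S <= sup T is already witnessed by
    sequences s_n in S and t_n in T, up to arbitrarily small errors at each
    point.  An explicit formula of Tong inserts a continuous function between
    inf s_n and sup t_n; being bounded, it extends to Y. *)

Require Import Defs.
From mathcomp Require Import all_boot all_order all_algebra.
From mathcomp Require Import all_classical all_reals all_analysis.
From mathcomp Require Import lra.

Set Implicit Arguments.
Unset Strict Implicit.
Unset Printing Implicit Defensive.

Import Order.TTheory GRing.Theory Num.Theory.
Import numFieldNormedType.Exports.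

Local Open Scope classical_set_scope.
Local Open Scope ring_scope.

(** * Infima and suprema in the ordered set of bounded functions *)

Section BoundedFunctionOrder.
Context (R : realType) (X : Type).
Implicit Types (f g h : bfun R X) (A : set (bfun R X)).

Lemma bfun_leP f g :
  reflect (forall x, val f x <= val g x) (f <= g)%O.
Proof. exact: lefP. Qed.

Lemma bounded_funP (f : X -> R) :
  (exists M, forall x, `|f x| <= M) <-> f \in (bounded_fun : set (X -> R)).
Proof.
split=> [[M fM]|/set_mem[M [_ fM]]].
  apply/mem_set; exists M; split; first exact: num_real.
  by move=> N /ltW MN x _; exact: le_trans (fM x) MN.
by exists (M + 1) => x; apply: fM => //; rewrite ltrDl.
Qed.

Lemma bfun_bound f : exists M, forall x, `|val f x| <= M.
Proof. by apply/bounded_funP/(valP f). Qed.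

(** Elements of B(X) need not be continuous, so one value can be changed freely. This is what makes
    infima and suprema in B(X) pointwise. *)
Definition update (f : X -> R) (x : X) (v : R) : X -> R :=
  fun y => if `[< y = x >] then v else f y.

Lemma update_bounded f x v :
  update (val f) x v \in (bounded_fun : set (X -> R)).
Proof.
have [M fM] := bfun_bound f.
apply/bounded_funP; exists (Num.max M `|v|) => y; rewrite /update.
by case: asboolP => _; rewrite le_max ?lexx ?orbT // fM.
Qed.

Definition bfun_update f x v : bfun R X := 
  exist _ (update (val f) x v) (update_bounded f x v).

Lemma bfun_update_same f x v : val (bfun_update f x v) x = v.
Proof. by rewrite /= /update; case: asboolP. Qed.

Lemma bfun_update_other f x v y : y <> x -> val (bfun_update f x v) y = val f y.
Proof. by rewrite /= /update; case: asboolP. Qed.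

Lemma bfun_opp_bounded f :
  (fun x => - val f x) \in (bounded_fun : set (X -> R)).
Proof.
have [M fM] := bfun_bound f.
by apply/bounded_funP; exists M => x; rewrite normrN.
Qed.

(** An order-reversing involution, by which facts about infima carry over to suprema. *)
Definition bfun_opp f : bfun R X := 
  exist _ (fun x => - val f x) (bfun_opp_bounded f).

Lemma bfun_oppK : involutive bfun_opp.
Proof. by move=> f; apply/val_inj/funext => x /=; rewrite opprK. Qed.

Lemma bfun_le_opp f g : (bfun_opp f <= bfun_opp g)%O = (g <= f)%O.
Proof. by apply/bfun_leP/bfun_leP => + x => /(_ x); rewrite /= lerN2. Qed.

Lemma infimums_opp A g :
  supremums A (bfun_opp g) -> infimums (bfun_opp @` A) g.
Proof.
move=> [Ag gA]; split.
  by move=> _ [f Af <-]; rewrite -bfun_le_opp bfun_oppK; exact: Ag.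
move=> h hA; rewrite -bfun_le_opp; apply: gA => f Af.
by rewrite -bfun_le_opp bfun_oppK; apply: hA; exists f.
Qed.

Lemma supremums_opp A g :
  infimums (bfun_opp @` A) g -> supremums A (bfun_opp g).
Proof.
move=> [Ag gA]; split.
  by move=> f Af; rewrite -bfun_le_opp bfun_oppK; apply: Ag; exists f.
move=> h hA; rewrite -bfun_le_opp bfun_oppK; apply: gA => _ [f Af <-].
by rewrite bfun_le_opp; exact: hA.
Qed.

(** Otherwise raising [g] by [eps] at the single point [x] would still give a lower bound of [A]. *)
Lemma infimums_approx A g x eps : infimums A g -> 0 < eps ->
  exists2 f, A f & val f x < val g x + eps.
Proof.
move=> [Ag gA] e0; apply: contrapT => nf.
suff : (bfun_update g x (val g x + eps) <= g)%O.
  by move=> /bfun_leP/(_ x); rewrite bfun_update_same gerDl leNgt e0.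
apply: gA => f Af; apply/bfun_leP => y.
have [->|yx] := pselect (y = x); last first.
  by rewrite bfun_update_other//; move: y {yx}; apply/bfun_leP/Ag.
by rewrite bfun_update_same leNgt; apply/negP => fx; apply: nf; exists f.
Qed.

Lemma supremums_approx A h x eps : supremums A h -> 0 < eps ->
  exists2 f, A f & val h x < val f x + eps.
Proof.
move=> Ah e0; have Ah' : infimums (bfun_opp @` A) (bfun_opp h).
  by apply: infimums_opp; rewrite bfun_oppK.
have [_ [f Af <-] /= fx] := infimums_approx x Ah' e0.
by exists f => //; lra.
Qed.

(** The pointwise infimum serves. It is a bounded function because it lies between [g] and the
    member [f0]. *)
Lemma infimums_exist A g f0 : lbound A g -> A f0 -> exists g', infimums A g'.
Proof.
move=> Ag Af0; pose m x := inf [set val f x | f in A].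
have lb x : lbound [set val f x | f in A] (val g x).
  by move=> _ [f Af <-]; apply/bfun_leP; exact: Ag.
have ne x : [set val f x | f in A] !=set0 by exists (val f0 x), f0.
have mle f x : A f -> m x <= val f x.
  by move=> Af; apply: ge_inf; [exists (val g x) | exists f].
have gem x b : lbound [set val f x | f in A] b -> b <= m x.
  by move=> bA; exact: lb_le_inf.
have mb : m \in (bounded_fun : set (X -> R)).
  have [M gM] := bfun_bound g; have [N fN] := bfun_bound f0.
  apply/bounded_funP; exists (Num.max M N) => x.
  have := gM x; have := fN x; have := mle _ x Af0; have := gem x _ (lb x).
  rewrite !ler_norml !le_max => gm mf /andP[f1 f2] /andP[g1 g2].
  rewrite (le_trans mf f2) orbT andbT lerNl (@le_trans _ _ M)//.
    by rewrite lerNl (le_trans g1).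
  by rewrite le_max lexx.
exists (exist _ m mb); split.
  by move=> f Af; apply/bfun_leP => x; exact: mle.
move=> h hA; apply/bfun_leP => x; apply: gem => _ [f Af <-].
by apply/bfun_leP; exact: hA.
Qed.

Lemma supremums_exist A g f0 : ubound A g -> A f0 -> exists g', supremums A g'.
Proof.
move=> Ag Af0.
have lb : lbound (bfun_opp @` A) (bfun_opp g).
  by move=> _ [f Af <-]; rewrite bfun_le_opp; exact: Ag.
have [g' /supremums_opp Ag'] := infimums_exist lb (imageP _ Af0).
by exists (bfun_opp g').
Qed.

End BoundedFunctionOrder.

(** * The Lindelöf property for indexed covers *)

Lemma lindelof_family (X : topologicalType) (I : Type) (P : set I)
    (W : I -> set X) : lindelof X ->
  (forall i, P i -> open (W i)) -> (forall x, exists2 i, P i & W i x) ->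
  exists Q : set I,
    [/\ Q `<=` P, countable Q & forall x, exists2 i, Q i & W i x].
Proof.
move=> lX oW cW.
have [[x0]|nX] := pselect (exists x : X, True); last first.
  by exists set0; split=> // x; case: nX; exists x.
move=> _; have [i0 _ _] := cW x0.
have oU u : (W @` P) u -> open u by move=> [i Pi <-]; exact: oW.
have cU : \bigcup_(u in W @` P) u = setT.
  rewrite -subTset => x _; have [i Pi Wi] := cW x.
  by exists (W i) => //; exists i.
have [V [VU cV UV]] := lX _ oU cU.
have [j jP] : {j : set X -> I & forall v, V v -> P (j v) /\ W (j v) = v}.
  apply: (@boolp.choice _ _ (fun v i => V v -> P i /\ W i = v)) => v.
  have [/VU[i Pi <-]|nV] := pselect (V v).
    by exists i.
  by exists i0.
exists (j @` V); split.
- by move=> _ [v /jP[Pv _] <-].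
- exact: (sub_countable (card_image_le _ _)).
- move=> x; have : [set: X] x by []; rewrite -UV => -[v Vv vx].
  by exists (j v); [exists v | rewrite (jP _ Vv).2].
Qed.

(** * Insertion of a continuous function between two sequences *)

Section Insertion.
Context (R : realType) (X : topologicalType).
Implicit Types (s t : nat -> X -> R) (a : X -> R).

Fixpoint running_min s n : X -> R :=
  if n is m.+1 then running_min s m \min s n else s 0.

Lemma running_min_le s n x : running_min s n x <= s n x.
Proof. by case: n => [|n] //=; rewrite ge_min lexx orbT. Qed.

Lemma running_min_decr s m n x : (m <= n)%N ->
  running_min s n x <= running_min s m x.
Proof.
move=> /subnKC <-; elim: (n - m)%N => [|k IH]; first by rewrite addn0.
by rewrite addnS (le_trans _ IH)//= ge_min lexx.
Qed.

Lemma running_min_attained s n x : exists i, running_min s n x = s i x.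
Proof.
elim: n => [|n [i IH]] /=; first by exists 0.
by rewrite IH /=; case: leP => _; [exists i | exists n.+1].
Qed.

Lemma running_min_continuous s n :
  (forall n, continuous (s n)) -> continuous (running_min s n).
Proof.
move=> cs; elim: n => [|n IH] //= x.
by apply: (@continuous_min R X); [exact: IH | exact: cs].
Qed.

(** Near [x] the function [a] is caught between some [F n] and [G m], which are continuous and
    nearly meet at [x]. *)
Lemma continuous_squeeze (F G : nat -> X -> R) a :
  (forall n, continuous (F n)) -> (forall n, continuous (G n)) ->
  (forall n x, F n x <= a x <= G n x) ->
  (forall x eps, 0 < eps -> exists m n, G m x < F n x + eps) ->
  continuous a.
Proof.
move=> cF cG aFG FG x; apply/cvgrPdist_lt => e e0.
(* One half pays for the gap between [F n] and [G m] at [x], the other for their variation near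
   [x]. *)
have e20 : 0 < e / 2 by lra.
have [m [n mn]] := FG x _ e20.
have /cvgrPdist_lt/(_ _ e20) nF := cF n x.
have /cvgrPdist_lt/(_ _ e20) nG := cG m x.
near=> y.
have : `|F n x - F n y| < e / 2 by near: y.
have : `|G m x - G m y| < e / 2 by near: y.
have /andP[] := aFG n x; have /andP[] := aFG m x.
have /andP[] := aFG n y; have /andP[] := aFG m y.
rewrite !ltr_distlC => *; apply/andP; lra.
Unshelve. all: by end_near. Qed.

(* Tong's formula: for s decreasing and t increasing the inserted function is
   sup_n min(s_n, t_n) = inf_n max(s_n, t_(n-1)). *)
Lemma monotone_insertion s t :
  (forall n, continuous (s n)) -> (forall n, continuous (t n)) ->
  (forall x m n, (m <= n)%N -> s n x <= s m x) ->
  (forall x m n, (m <= n)%N -> t m x <= t n x) ->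
  (forall x eps, 0 < eps -> exists m n, s m x < t n x + eps) ->
  exists a, [/\ continuous a,
    forall x, Num.min (s 0 x) (t 0 x) <= a x <= s 0 x,
    forall x eps, 0 < eps -> exists n, s n x < a x + eps &
    forall x eps, 0 < eps -> exists n, a x < t n x + eps].
Proof.
move=> cs ct sD tI st.
pose F n := s n \min t n.
pose G n := if n is m.+1 then s n \max t m else s 0.
have FG x m n : F m x <= G n x.
  rewrite /F /G /= ge_min; case: n => [|n]; first by rewrite sD.
  rewrite /= !le_max; have [mn|nm] := leqP m n.
    by rewrite (tI x m n mn) !orbT.
  by rewrite (sD x n.+1 m nm).
pose a x := sup (range (F ^~ x)).
have Fa n x : F n x <= a x.
  by apply: ub_le_sup; [exists (G 0 x) => _ [m _ <-] | exists n].
have aleP x b : (forall n, F n x <= b) -> a x <= b.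
  move=> Fb; apply: ge_sup; first by exists (F 0 x), 0.
  by move=> _ [n _ <-].
have aG n x : a x <= G n x by apply: aleP.
have gap x eps : 0 < eps -> exists m n, G m x < F n x + eps.
  move=> e0; apply: contrapT => nFG.
  have aq m : a x + eps <= G m x.
    rewrite -lerBrDr; apply: aleP => n; rewrite lerBrDr leNgt.
    by apply/negP => mn; apply: nFG; exists m, n.
  (* If every [G m] stays [eps] above [a] at [x], then [t n <= a] forces [s n.+1] to carry the
     maximum [G n.+1], and then [F n.+1 <= a] forces [t n.+1 <= a]. The index shift in [G] drives
     this induction, whose outcome contradicts [st]. *)
  have st_gap n : a x + eps <= s n x /\ t n x <= a x.
    elim: n => [|n [_ IH]].
      split; first exact: (aq 0).
      by have := Fa 0 x; have := aq 0; rewrite /F /G /= ge_min => *; lra.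
    have sq : a x + eps <= s n.+1 x.
      have := aq n.+1; rewrite /G /= le_max => /orP[//|]; lra.
    split=> //; have := Fa n.+1 x; rewrite /F /= ge_min => /orP[|//]; lra.
  have [m [n mn]] := st x _ e0.
  have [sN tN] := st_gap (maxn m n).
  have := sD x _ _ (leq_maxl m n); have := tI x _ _ (leq_maxr m n); lra.
exists a; split.
- apply: (@continuous_squeeze F G) => //.
  + by move=> n x; apply: (@continuous_min R X); [exact: cs | exact: ct].
  + case=> [|n] //= x.
    by apply: (@continuous_max R X); [exact: cs | exact: ct].
  + by move=> n x; rewrite Fa aG.
- by move=> x; rewrite (Fa 0) (aG 0).
- move=> x eps /(gap x)[m [n mn]]; exists m.
  have := Fa n x; suff : s m x <= G m x by lra.
  by case: (m) => [|k] //=; rewrite le_max lexx.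
- move=> x eps /(gap x)[m [n mn]]; exists n.
  have := aG m x; suff : F n x <= t n x by lra.
  by rewrite /F /= ge_min lexx orbT.
Qed.

(** Running minima of [s] and running maxima of [t] reduce this to the monotone case. Each running
    value is attained by a term of the original sequence, so the approximations carry back, and
    index 0 is unchanged. The bounds at index 0 will make [a] bounded. *)
Lemma sequence_insertion s t :
  (forall n, continuous (s n)) -> (forall n, continuous (t n)) ->
  (forall x eps, 0 < eps -> exists m n, s m x < t n x + eps) ->
  exists a, [/\ continuous a,
    forall x, Num.min (s 0 x) (t 0 x) <= a x <= s 0 x,
    forall x eps, 0 < eps -> exists n, s n x < a x + eps &
    forall x eps, 0 < eps -> exists n, a x < t n x + eps].
Proof.
move=> cs ct st.
pose t' n x := - running_min (fun k y => - t k y) n x.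
have [|||||a [ca abd sa ta]] := @monotone_insertion (running_min s) t'.
- by move=> n; exact: running_min_continuous.
- move=> n x; apply: (@continuousN R R X).
  apply: running_min_continuous => k y.
  by apply: continuousN; exact: ct.
- by move=> x m n; exact: running_min_decr.
- by move=> x m n mn; rewrite lerN2 running_min_decr.
- move=> x eps /(st x)[m [n mn]]; exists m, n.
  have := running_min_le s m x; have := running_min_le (fun k y => - t k y) n x.
  by rewrite /t'; lra.
exists a; split=> //.
- by move=> x; have := abd x; rewrite /t' /= opprK.
- move=> x eps /(sa x)[n nx]; have [i sx] := running_min_attained s n x.
  by exists i; rewrite -sx.
- move=> x eps /(ta x)[n]; rewrite /t'.
  have [i ->] := running_min_attained (fun k y => - t k y) n x.
  by exists i; lra.
Qed.

End Insertion.

(** * Consequences of (SL): the Lindelöf property and extension of functions *)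

Section CompactificationExtensions.
Context (R : realType) (X Y : topologicalType) (e : compactification X Y).

(** Only values in the unit interval are considered, since these functions are the coordinates of
    the cube containing the Stone-Cech space. *)
Definition extends_unit_functions : Prop :=
  forall u : continuousType X R, unit_cfun u ->
    exists a : continuousType Y R, a \o e = u.

Lemma embedding_continuous : continuous e.
Proof. by have [] := compactification_embedding e. Qed.

Lemma urysohn_point (V : set Y) (y : Y) : open V -> V y ->
  exists f : continuousType Y R,
    [/\ forall z, 0 <= f z <= 1, f y = 1 & forall z, ~ V z -> f z = 0].
Proof.
move=> oV Vy; have hY := compactification_hausdorff e.
have nY := compact_normal hY (compactification_compact e).
have cly : closed [set y].
  exact/accessible_closed_set1/hausdorff_accessible.
have dis : ~` V `&` [set y] = set0.
  by rewrite -subset0 => z [nVz zy]; apply: nVz; rewrite zy.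
have [f [cf f0 f1 f01]] :=
  @urysohn_ext_itv _ R nY _ _ 0 1 (open_closedC oV) cly dis ltr01.
exists (mkcts cf); split.
- move=> z; have /f01 : range f (f z) by exists z.
  by rewrite /= in_itv.
- by apply: f1; exists y.
- by move=> z nVz; apply: f0; exists z.
Qed.

Lemma urysohn_embedding (W : set X) (x : X) : open W -> W x ->
  exists f : continuousType Y R,
    [/\ forall z, 0 <= f z <= 1, f (e x) = 1 & forall y, ~ W y -> f (e y) = 0].
Proof.
have [inj _ emb] := compactification_embedding e.
move=> oW Wx; have [V oV eW] := emb W oW.
have /[1!eW][[Vx _]] : (e @` W) (e x) by exists x.
have [f [f01 f1 f0]] := urysohn_point oV Vx.
exists f; split=> // y nWy; apply: f0 => Vy; apply: nWy.
have : (V `&` range e) (e y) by split=> //; exists y.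
by rewrite -eW => -[z Wz /inj <-].
Qed.

Lemma cfun_eq_on_dense (f g : continuousType Y R) : f \o e = g \o e ->
  f = g :> (Y -> R).
Proof.
move=> fg; apply/funext => y; apply/eqP; rewrite -subr_eq0.
apply/negP => /negP ne.
pose d z := f z - g z.
have cd : continuous d.
  by move=> z; apply: (@continuousB R R); exact: cts_fun.
have oO : open (d @^-1` [set~ 0]).
  apply: open_comp => [z _|]; first exact: cd.
  rewrite openC; apply/accessible_closed_set1/hausdorff_accessible.
  exact: norm_hausdorff.
have [|z [dz [x _ xz]]] := compactification_dense e _ oO.
  by exists y => /=; exact/eqP.
apply: dz; rewrite /= /d -xz.
by rewrite -[f (e x)]/((f \o e) x) fg subrr.
Qed.

(** A scaled Urysohn bump at [e x], vanishing on [X] wherever [u] is not above [u x - eps / 2].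
    Hence [u] is the pointwise supremum of restrictions of continuous functions on [Y]. *)
Lemma approx_below (u : X -> R) x (eps : R) : continuous u ->
  (forall y, 0 <= u y) -> 0 < eps ->
  exists2 f : continuousType Y R, forall y, f (e y) <= u y &
    u x < f (e x) + eps.
Proof.
move=> cu u0 e0; have e20 : 0 < eps / 2 by lra.
pose W := u @^-1` [set r | u x - eps / 2 < r].
have oW : open W by apply: open_comp => [z _|]; [exact: cu | exact: open_gt].
have Wx : W x by rewrite /W /=; lra.
have [f [f01 f1 f0]] := urysohn_embedding oW Wx.
(* The maximum with 0 ensures [c * f z <= c]; on [W] both arguments are at most [u]. *)
pose c := Num.max 0 (u x - eps / 2).
have c0 : 0 <= c by rewrite le_max lexx.
have cf : continuous (fun z => c * f z).
  by move=> z; apply: (@continuousM R Y);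
    [exact: cst_continuous | exact: cts_fun].
pose g : continuousType Y R := mkcts cf.
have gE z : g z = c * f z by [].
exists g; last first.
  rewrite gE f1 mulr1; have : u x - eps / 2 <= c by rewrite le_max lexx orbT.
  lra.
move=> y; rewrite gE.
have [Wy|nWy] := pselect (W y); last by rewrite f0// mulr0.
have /andP[_ fy] := f01 (e y).
rewrite (le_trans (ler_piMr c0 fy))// /c ge_max u0/=.
exact: ltW.
Qed.

Lemma SL_lindelof : SL R e -> lindelof X.
Proof.
move=> sl U oU cU.
pose one : continuousType Y R := mkcts (@cst_continuous Y R 1).
pose T := [set f : continuousType Y R | (forall z, 0 <= f z <= 1) /\
  exists2 u, U u & forall y, ~ u y -> f (e y) = 0].
have i1 : infimums (basic_extension e @` [set one]) (basic_extension e one).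
  by split=> [_ [_ -> <-]//|h]; apply; exists one.
have s1 : supremums (basic_extension e @` T) (basic_extension e one).
  split=> [_ [f [f01 _] <-]|h hT].
    by apply/bfun_leP => x /=; have /andP[] := f01 (e x).
  apply/bfun_leP => x; have [u Uu ux] : (\bigcup_(u in U) u) x by rewrite cU.
  have [f [f01 f1 f0]] := urysohn_embedding (oU _ Uu) ux.
  have Tf : T f by split=> //; exists u.
  have /bfun_leP/(_ x) := hT _ (imageP (basic_extension e) Tf).
  by rewrite /= f1.
have [S' [T' [a [g' [h' [[S1 _] [TT' cT'] iS' sT' /andP[ga ah]]]]]]] :=
  sl _ _ _ _ i1 s1 (lexx _).
(* The constant 1 is a lower bound of [S'] even if [S'] is empty, so it lies below [g']. *)
have h1 : (basic_extension e one <= h')%O.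
  apply: le_trans (le_trans ga ah); apply: iS'.2 => _ [f /S1 -> <-].
  exact: lexx.
(* A point of [X] yields a member of [U], the default value of [j] outside [T']. *)
have [x0|nX] := pselect (exists x : X, True); last first.
  exists set0; split=> //; rewrite -subTset => x _.
  by case: nX; exists x.
have U0 : exists u, U u.
  have [x _] := x0; have [u Uu _] : (\bigcup_(u in U) u) x by rewrite cU.
  by exists u.
have [j jP] : {j : continuousType Y R -> set X &
    forall f, T' f -> U (j f) /\ forall y, ~ j f y -> f (e y) = 0}.
  apply: (@boolp.choice _ _ (fun (f : continuousType Y R) u => T' f ->
    U u /\ forall y, ~ u y -> f (e y) = 0)) => f.
  have [/TT'[_ [u Uu u0]]|nT] := pselect (T' f); first by exists u.
  by have [u _] := U0; exists u.
exists (j @` T'); split.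
- by move=> _ [f /jP[Uf _] <-].
- exact: (sub_countable (card_image_le _ _)).
rewrite -subTset => x _; apply: contrapT => nx.
(* At an uncovered [x] all members of [T'] vanish, so 1 lowered to 0 at [x] still bounds [T'] from
   above, against [1 <= h']. *)
suff : (h' <= bfun_update (basic_extension e one) x 0)%O.
  move=> /(le_trans h1)/bfun_leP/(_ x).
  by rewrite bfun_update_same /= ler10.
apply: sT'.2 => _ [f Tf <-]; apply/bfun_leP => y.
have [->|yx] := pselect (y = x); last first.
  rewrite bfun_update_other//=; have [f01 _] := TT' _ Tf.
  by have /andP[] := f01 (e y).
rewrite bfun_update_same /= (jP _ Tf).2// => jx.
by apply: nx; exists (j f) => //; exists f.
Qed.

Lemma SL_extends : SL R e -> extends_unit_functions.
Proof.
move=> sl u u01.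
have ux x : 0 <= u x <= 1.
  have : (range u) (u x) by exists x.
  by move/u01; rewrite /= in_itv.
have cu : continuous u by exact: cts_fun.
have ub : (u : X -> R) \in (bounded_fun : set (X -> R)).
  apply/bounded_funP; exists 1 => x.
  by have /andP[? ?] := ux x; rewrite ger0_norm.
pose v : bfun R X := exist _ (u : X -> R) ub.
pose S := [set f : continuousType Y R | forall y, u y <= f (e y)].
pose T := [set f : continuousType Y R | forall y, f (e y) <= u y].
have iS : infimums (basic_extension e @` S) v.
  split=> [_ [f Sf <-]|h hS]; first exact/bfun_leP.
  apply/bfun_leP => x; apply/ler_addgt0Pr => eps e0.
  (* The reflection [r -> 1 - r] turns approximation of [u] from above into approximation of [1 - u]
     from below. *)
  have cu1 : continuous (fun y => 1 - u y).
    move=> y; apply: (@continuousB R R); first exact: cst_continuous.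
    exact: cu.
  have [|f fu uf] := approx_below x cu1 _ e0.
    by move=> y; have /andP[] := ux y; rewrite subr_ge0.
  have cf : continuous (fun z => 1 - f z).
    move=> y; apply: (@continuousB R R); first exact: cst_continuous.
    exact: cts_fun.
  pose g : continuousType Y R := mkcts cf.
  have gE z : g z = 1 - f z by [].
  have Sg : S g by move=> y; rewrite gE; have := fu y; lra.
  have /bfun_leP/(_ x) /= := hS _ (imageP (basic_extension e) Sg).
  by rewrite gE; lra.
have sT : supremums (basic_extension e @` T) v.
  split=> [_ [f Tf <-]|h hT]; first exact/bfun_leP.
  apply/bfun_leP => x; apply/ler_addgt0Pr => eps e0.
  have [|f Tf uf] := approx_below x cu _ e0.
    by move=> y; have /andP[] := ux y.
  have /bfun_leP/(_ x) /= := hT _ (imageP (basic_extension e) (Tf : T f)).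
  by lra.
have [S' [T' [a [g' [h' [[SS' _] [TT' _] iS' sT' /andP[ga ah]]]]]]] :=
  sl _ _ _ _ iS sT (lexx _).
(* On [X] this is the chain [a <= h' <= u <= g' <= a]: [u] is an upper bound of [T'] and a lower
   bound of [S']. *)
exists a; suff av : basic_extension e a = v by exact: (congr1 val av).
apply/eqP; rewrite eq_le; apply/andP; split.
  by apply: (le_trans ah); apply: sT'.2 => _ [f /TT' Tf <-]; exact/bfun_leP.
by apply: (le_trans _ ga); apply: iS'.2 => _ [f /SS' Sf <-]; exact/bfun_leP.
Qed.

End CompactificationExtensions.

(** * Maps into products and out of compact spaces *)

Lemma continuous_ptws (I : Type) (T V : topologicalType)
    (f : T -> {ptws I -> V}) :
  (forall i, continuous (fun x => f x i)) -> continuous f.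
Proof.
move=> cf x; apply/cvg_sup => i; move: x.
apply/(@continuousP _ (initial_topology (fun g : {ptws I -> V} => g i))).
move=> A [B oB <-]; have /continuousP := cf i; exact.
Qed.

(* The inverse is continuous because [g] is a closed map. *)
Lemma compact_hausdorff_bijection (Y Z : topologicalType) (g : Y -> Z) :
  compact [set: Y] -> hausdorff_space Z -> continuous g -> injective g ->
  (forall z, exists y, g y = z) ->
  exists g' : Z -> Y, [/\ continuous g', cancel g g' & cancel g' g].
Proof.
move=> cY hZ cg inj /(@boolp.choice _ _ (fun z y => g y = z))[g' gK].
have g'K : cancel g g' by move=> y; apply: inj; rewrite gK.
exists g'; split=> //; apply/continuous_closedP => A clA.
have -> : g' @^-1` A = g @` A.
  by apply/seteqP; split=> [z Az|_ [y Ay <-]]; [exists (g' z) | rewrite /= g'K].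
apply: (compact_closed hZ); apply: continuous_compact.
  exact: continuous_subspaceT.
exact: (subclosed_compact clA cY).
Qed.

(** * Comparison with the Stone-Cech compactification, and the converse direction *)

Section StoneCechExtension.
Context (R : realType) (X Y : topologicalType).
Context (crX : completely_regular X) (e : compactification X Y).

Local Notation UX := (@unit_cfun R X).

(** The chosen extensions are the coordinates of a continuous map from [Y] to the cube; it is a
    bijection onto the Stone-Cech space, hence a homeomorphism by compactness. *)
Lemma extends_isomorphic : extends_unit_functions R e ->
  compactification_isomorphic e (stone_cech R crX).
Proof.
move=> ext.
have [E EP] : {E : UX -> continuousType Y R &
    forall u : UX, E u \o e = set_val u}.
  apply: (@boolp.choice _ _
    (fun (u : UX) (a : continuousType Y R) => a \o e = set_val u)) => u.
  by apply: ext; exact: set_valP.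
pose G0 (y : Y) : {ptws UX -> R} := fun u => E u y.
have cG0 : continuous G0.
  by apply: continuous_ptws => u; exact: cts_fun.
have G0e x : G0 (e x) = @stone_cech_eval R X x.
  by apply/funext => u; rewrite /G0 /stone_cech_eval -EP.
have clG y : G0 y \in closure (range (@stone_cech_eval R X)).
  apply/mem_set => B /cG0; rewrite nbhsE => -[V [oV Vy] VB].
  have [|z [Vz [x _ xz]]] := compactification_dense e _ oV; first by exists y.
  exists (G0 z); split; last exact: VB.
  by exists x => //; rewrite -xz G0e.
pose G y : stone_cech_space R X := exist _ (G0 y) (clG y).
have cG : continuous G by apply: continuous_comp_initial.
have Ge x : G (e x) = stone_cech_fun R x by apply: val_inj; exact: G0e.
have injG : injective G.
  move=> y z /(congr1 val) /= yz; apply: contrapT => ne.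
  have oz : open (~` [set z]).
    rewrite openC; apply/accessible_closed_set1/hausdorff_accessible.
    exact: (compactification_hausdorff e).
  have [f [f01 fy fz]] := urysohn_point R e oz ne.
  have cfe : continuous (f \o e).
    move=> x; apply: continuous_comp; first exact: embedding_continuous.
    exact: cts_fun.
  pose u0 : continuousType X R := mkcts cfe.
  have u01 : unit_cfun u0.
    by move=> _ [x _ <-]; rewrite /= in_itv; exact: f01.
  pose u : UX := exist _ u0 (mem_set u01).
  (* By density the chosen extension of [f \o e] is [f] itself, so the coordinate [u] of [G]
     separates [y] from [z]. *)
  have Ef : E u = f :> (Y -> R).
    by apply: (cfun_eq_on_dense (e := e)); rewrite EP.
  have := congr1 (@^~ u) yz; rewrite /G0 Ef fy fz; last by apply.
  by move/eqP; rewrite oner_eq0.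
(* The range is compact, hence closed, and contains the dense image of [X]. *)
have surG z : exists y, G y = z.
  have clR : closed (range G).
    apply: compact_closed; first exact: stone_cech_space_hausdorff.
    apply: continuous_compact; first exact: continuous_subspaceT.
    exact: (compactification_compact e).
  suff : closure (range G) z.
    by rewrite -(closure_id _).1// => -[y _ <-]; exists y.
  move=> B; rewrite nbhsE => -[V [oV Vz] VB].
  have [|w [Vw [x _ xw]]] := compactification_dense (stone_cech R crX) _ oV.
    by exists z.
  exists w; split; last exact: VB.
  by exists (e x) => //; rewrite Ge.
have [G' [cG' GK G'K]] := compact_hausdorff_bijection
  (compactification_compact e) (@stone_cech_space_hausdorff R X) cG injG surG.
exists id, G, id, G'; split=> //; split=> //.
- by move=> x; exact: cvg_id.
- by apply/funext => x /=; rewrite Ge.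
- by move=> x; exact: cvg_id.
- by apply/funext => x /=; rewrite -Ge GK.
Qed.

Lemma isomorphic_extends (a : X -> R) (M : R) :
  compactification_isomorphic e (stone_cech R crX) ->
  continuous a -> (forall x, `|a x| <= M) ->
  exists A : continuousType Y R, A \o e = a.
Proof.
move=> [f [g [f' [g' [[cf cg ge] [cf' _ _] [fK _] _]]]]] ca aM.
(* [M] may be negative when [X] is empty; this [N] is positive and bounds [a] in any case. *)
pose N := 1 + `|M|.
have N0 : 0 < N by rewrite ltr_pwDl.
(* The isomorphism may move [X] by [f]; composing with [f'] compensates for this. The affine
   rescaling makes [w] a coordinate of the cube. *)
pose w x := (a (f' x) + N) / (2 * N).
have cw : continuous w.
  move=> x; apply: (@continuousM R X); last exact: cst_continuous.
  apply: (@continuousD R R); last exact: cst_continuous.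
  by apply: continuous_comp; [exact: cf' | exact: ca].
have w01 : unit_cfun (mkcts cw : continuousType X R).
  move=> _ [x _ <-]; rewrite /= in_itv /= /w.
  have := aM (f' x); have := ler_norm M; rewrite ler_norml /N => *.
  apply/andP; split; first by apply: divr_ge0; lra.
  by rewrite ler_pdivrMr; lra.
pose u : UX := exist _ (mkcts cw : continuousType X R) (mem_set w01).
pose ev y : R := (set_val (g y) : {ptws UX -> R}) u.
have cev : continuous ev.
  move=> y; apply: (@continuous_comp _ _ _ g
    (fun z => (set_val z : {ptws UX -> R}) u)).
    exact: cg.
  apply: (@continuous_comp _ _ _ _ (fun p : {ptws UX -> R} => p u)).
    exact: initial_continuous.
  exact: (@proj_continuous UX (fun=> R) u).
have cA : continuous (fun y => 2 * N * ev y - N).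
  move=> y; apply: (@continuousB R R Y); last exact: cst_continuous.
  by apply: (@continuousM R Y); [exact: cst_continuous | exact: cev].
pose A : continuousType Y R := mkcts cA.
have AE y : A y = 2 * N * ev y - N by [].
exists A; apply/funext => x; rewrite [LHS]AE.
have /= gx := congr1 (@^~ x) ge.
have -> : ev (e x) = w (f x) by rewrite /ev gx.
rewrite /w fK mulrCA divff ?mulr1 ?addrK//.
by rewrite mulf_neq0// gt_eqF.
Qed.

Lemma lindelof_isomorphic_SL :
  lindelof X -> compactification_isomorphic e (stone_cech R crX) -> SL R e.
Proof.
move=> lX iso S T g h iS sT gh.
pose be := @basic_extension R X Y e.
(* Over an empty [X] all elements of B(X) are equal, so empty subsets serve. Otherwise [x0] makes
   the family [K] below nonempty, hence enumerable by a sequence. *)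
have [[x0 _]|nX] := pselect (exists x : X, True); last first.
  pose z : continuousType Y R := mkcts (@cst_continuous Y R 0).
  have le (k l : bfun R X) : (k <= l)%O.
    by apply/bfun_leP => x; case: nX; exists x.
  exists set0, set0, z, (be z), (be z).
  split=> //; try (by split=> // *; exact: le).
  by rewrite !le.
(* For each error [1 / (n + 1)], the open sets on which a pair from [S] and [T] satisfies the
   inequality up to that error cover [X]; the Lindelöf property leaves countably many pairs. *)
have app n : exists Q : set (continuousType Y R * continuousType Y R),
    [/\ Q `<=` S `*` T, countable Q &
    forall x, exists2 p, Q p & p.1 (e x) < p.2 (e x) + n.+1%:R^-1].
  apply: (lindelof_family (P := S `*` T)
    (W := fun p => [set x | p.1 (e x) < p.2 (e x) + n.+1%:R^-1])) => //.
    move=> [s t] _ /=.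
    have ce (k : continuousType Y R) : continuous (k \o e).
      move=> y; apply: continuous_comp; first exact: embedding_continuous.
      exact: cts_fun.
    have cd : continuous (fun x => (t \o e) x + n.+1%:R^-1 - (s \o e) x).
      move=> x; apply: (@continuousB R R X); last exact: ce.
      by apply: (@continuousD R R X); [exact: ce | exact: cst_continuous].
    have := open_comp (fun x _ => cd x) (@open_gt R 0).
    by congr open; apply/seteqP; split=> x /=; rewrite subr_gt0.
  move=> x; have n0 : 0 < n.+1%:R^-1 / 2 :> R by rewrite divr_gt0.
  have [_ [s Ss <-] /= sx] := infimums_approx x iS n0.
  have [_ [t Tt <-] /= tx] := supremums_approx x sT n0.
  exists (s, t) => //=; have /bfun_leP/(_ x) /= := gh.
  by move: sx tx; set d := _^-1 => /=; lra.
have [Q QP] := boolp.choice app.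
pose K := \bigcup_n Q n.
have KST : K `<=` S `*` T.
  by move=> p [n _ Qp]; have [QST _ _] := QP n; exact: QST.
have cK : countable K.
  by apply: bigcup_countable => // n _; have [_ cQ _] := QP n.
have [p0 Kp0] : exists p, K p.
  have [_ _ /(_ x0)[p Qp _]] := QP 0.
  by exists p, 0.
have [q qK] : exists q : nat -> continuousType Y R * continuousType Y R,
    range q = K.
  have /pfcard_geP[K0|[q]] := cK; first by rewrite K0 in Kp0.
  by exists q; exact: image_eq.
pose s n := (q n).1 \o e; pose t n := (q n).2 \o e.
have ce (k : continuousType Y R) : continuous (k \o e).
  move=> y; apply: continuous_comp; first exact: embedding_continuous.
  exact: cts_fun.
have cs n : continuous (s n) by exact: ce.
have ct n : continuous (t n) by exact: ce.
have qST n : S (q n).1 /\ T (q n).2.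
  by apply: KST; rewrite -qK; exists n.
have st x eps : 0 < eps -> exists m n, s m x < t n x + eps.
  move=> e0; have [k kN] : exists k, k.+1%:R^-1 < eps.
    by have [k _ kP] := near_infty_natSinv_lt (PosNum e0);
      exists k; apply: kP => /=.
  have [_ _ /(_ x)[p Qp px]] := QP k.
  have : K p by exists k.
  rewrite -qK => -[n _ qn]; exists n, n; rewrite /s /t qn /=.
  by rewrite (lt_trans px)// ltrD2l.
have [a [ca ab sa ta]] := sequence_insertion cs ct st.
have [M1 M1P] := bfun_bound (be (q 0).1).
have [M2 M2P] := bfun_bound (be (q 0).2).
(* Boundedness of [a], needed to extend it to [Y], comes from the bounds at index 0. *)
have aM x : `|a x| <= Num.max M1 M2.
  have m1 : M1 <= Num.max M1 M2 by rewrite le_max lexx.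
  have m2 : M2 <= Num.max M1 M2 by rewrite le_max lexx orbT.
  have := M1P x; have := M2P x; have := ab x.
  rewrite /s /t /= !ler_norml ge_min => /andP[l ax] /andP[l2 u2] /andP[l1 u1].
  by move: l => /orP[] l; apply/andP; lra.
have [A Ae] := isomorphic_extends iso ca aM.
pose S' := range (fun n => (q n).1); pose T' := range (fun n => (q n).2).
have SS' : S' `<=` S by move=> _ [n _ <-]; have [] := qST n.
have TT' : T' `<=` T by move=> _ [n _ <-]; have [] := qST n.
have [g' gP] : exists g', infimums (be @` S') g'.
  apply: (@infimums_exist _ _ _ g (be (q 0).1)); last first.
    by exists (q 0).1 => //; exists 0.
  by move=> _ [f /SS' Sf <-]; apply: iS.1; exists f.
have [h' hP] : exists h', supremums (be @` T') h'.
  apply: (@supremums_exist _ _ _ h (be (q 0).2)); last first.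
    by exists (q 0).2 => //; exists 0.
  by move=> _ [f /TT' Tf <-]; apply: sT.1; exists f.
have bA x : val (be A) x = a x by rewrite -Ae.
have cR I : countable (range (I : nat -> continuousType Y R)).
  exact: (sub_countable (card_image_le _ _)).
exists S', T', A, g', h'; split=> //.
- by split=> //; exact: cR.
- by split=> //; exact: cR.
apply/andP; split; apply/bfun_leP => x.
- apply/ler_addgt0Pr => eps /(sa x)[n nx]; rewrite bA.
  have /bfun_leP/(_ x) : (g' <= be (q n).1)%O.
    by apply: gP.1; exists (q n).1 => //; exists n.
  by move=> /= gx; apply: le_trans gx (ltW nx).
- apply/ler_addgt0Pr => eps /(ta x)[n nx]; rewrite bA.
  have /bfun_leP/(_ x) : (be (q n).2 <= h')%O.
    by apply: hP.1; exists (q n).2 => //; exists n.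
  by move=> /= gx; apply: le_trans (ltW nx) _; rewrite lerD2r.
Qed.

End StoneCechExtension.

Theorem theorem4p14 (R : realType) (X Y : topologicalType)
    (crX : completely_regular X) (e : compactification X Y) :
  SL R e <->
  lindelof X /\ compactification_isomorphic e (stone_cech R crX).
Proof.
split=> [sl|[lX iso]]; last exact: lindelof_isomorphic_SL iso.
by split; [exact: (SL_lindelof sl) | exact/extends_isomorphic/SL_extends].
Qed.
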